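(* Let $\pi$ be picked uniformly at random from all permutations of length $k$. With probability $1-o(1)$ (where the $o(1)$ term tends to zero as $k \to \infty$) the following holds: the query complexity of any non-adaptive one-sided $\varepsilon$-test for $\pi$-freeness is $\Omega\!\left(\varepsilon^{-\frac{1}{k-3}} n^{1 - \frac{1}{k-3}}\right)$.
   Context: A permutation $\pi=(\pi_1,\dots,\pi_k)$ of $[k]$ is viewed as a sequence. A sequence $f\colon[n]\to\mathbb{R}$ contains $\pi$ if there exist indices $i_1<\dots<i_k$ in $[n]$ such that for all $a,b$, $f(i_a)<f(i_b)$ iff $\pi_a<\pi_b$; otherwise $f$ is $\pi$-free. $f$ is $\varepsilon$-far from $\pi$-freeness if one must change more than $\varepsilon n$ values of $f$ to make it $\pi$-free. A one-sided $\varepsilon$-test for $\pi$-freeness is a randomized algorithm with query access to $f\colon[n]\to\mathbb{R}$ that always accepts $\pi$-free $f$ and rejects with probability at least $2/3$ every $f$ that is $\varepsilon$-far; it is non-adaptive if all queries are chosen before any answer is received. Query complexity is the maximum number of queries. Asymptotic notation in $n,\varepsilon$ regards $k$ as a constant. *)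

(* Defs.v *)
From HB Require Import structures.
From mathcomp Require Import all_boot all_order all_algebra all_fingroup.
From mathcomp Require Import all_classical all_reals all_analysis.

Set Implicit Arguments.
Unset Strict Implicit.
Unset Printing Implicit Defensive.

Import Order.TTheory GRing.Theory Num.Theory.
Import numFieldNormedType.Exports.

Local Open Scope classical_set_scope.
Local Open Scope ring_scope.

(* [k] and [n] are indexed from 0: a pattern is p : 'S_k with p a in 'I_k. *)
Definition contains (R : realType) (k n : nat) (p : 'S_k) (f : 'I_n -> R) : Prop :=
  exists idx : 'I_k -> 'I_n,
    (forall a b : 'I_k, (a < b)%N -> (idx a < idx b)%N) /\
    (forall a b : 'I_k, f (idx a) < f (idx b) <-> (p a < p b)%N).

Definition pattern_free (R : realType) (k n : nat) (p : 'S_k) (f : 'I_n -> R) : Prop :=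
  ~ contains p f.

Definition eps_far (R : realType) (k n : nat) (p : 'S_k) (eps : R)
    (f : 'I_n -> R) : Prop :=
  forall g : 'I_n -> R, pattern_free p g ->
    eps * n%:R < #|[pred i | f i != g i]|%:R.

(* The internal randomness of the algorithm is a point w of the probability
   space T.  Non-adaptivity: the list of queries depends on w only, and the
   verdict on w and the list of answers. *)
Record nonadaptive_alg (R : realType) (d : measure_display)
    (T : measurableType d) (n : nat) := NonadaptiveAlg {
  queries : T -> seq 'I_n;
  decide : T -> seq R -> bool;
  measurable_queries : forall s : seq 'I_n,
    measurable [set w | queries w = s];
  measurable_decide : forall f : 'I_n -> R,
    measurable [set w | decide w (map f (queries w))]
}.

Definition accepts (R : realType) (d : measure_display) (T : measurableType d)
    (n : nat) (A : nonadaptive_alg R T n) (f : 'I_n -> R) (w : T) : bool :=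
  decide A w (map f (queries A w)).

Definition query_complexity (R : realType) (d : measure_display)
    (T : measurableType d) (n : nat) (A : nonadaptive_alg R T n) : \bar R :=
  ereal_sup (range (fun w : T => (size (queries A w))%:R%:E)).

Definition one_sided_test (R : realType) (k n : nat) (p : 'S_k) (eps : R)
    (d : measure_display) (T : measurableType d) (P : probability T R)
    (A : nonadaptive_alg R T n) : Prop :=
  (forall f : 'I_n -> R, pattern_free p f -> forall w : T, accepts A f w) /\
  (forall f : 'I_n -> R, eps_far p eps f ->
     ((2 / 3)%:E <= P [set w | ~~ accepts A f w])%E).

(* Every non-adaptive one-sided eps-test for p-freeness makes Omega(b eps n)
   queries.  The constants c and eps0 may depend on p, hence on k, but not on
   eps and n.  For eps close to 1 there may be no eps-far f.  Without 1 <= eps * n the bounds of interest may exceed n, the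
   number of queries that read the whole input. *)
Definition nonadaptive_one_sided_Omega (R : realType) (k : nat) (p : 'S_k)
    (b : R -> nat -> R) : Prop :=
  exists c eps0 : R, [/\ 0 < c, 0 < eps0 &
    forall (eps : R) (n : nat), 0 < eps <= eps0 -> 1 <= eps * n%:R ->
    forall (d : measure_display) (T : measurableType d) (P : probability T R)
           (A : nonadaptive_alg R T n),
      one_sided_test p eps P A -> ((c * b eps n)%:E <= query_complexity A)%E].

Definition uniform_perm_prob (R : realType) (k : nat) (E : 'S_k -> Prop) : R :=
  #|[pred p : 'S_k | `[< E p >]]|%:R / #|{: 'S_k}|%:R.

(* Main.v *)
(** Call a position pair (w, w+1) of the pattern wide if almost all values lie
    between its two values.  For a random pattern there is a wide ascending pair
    such that the neighbours of the minimal and of the maximal entry have values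
    strictly inside it.  Glue three adjacent pairs: the wide one, the minimum
    with its neighbour towards w, and the maximum with its neighbour towards w.
    This leaves k-3 blocks.  The hard sequences consist of k-3 consecutive
    intervals, the j-th of which lists m translates ("classes") of block j, in
    increasing or in decreasing order.  With suitable directions an occurrence of
    the pattern cannot get ahead of the identity placement left of w, nor fall
    behind it right of w; so the wide pair lies in its own block, where the
    direction forces both entries into one class.  All values in between are then
    in this class too, hence at their own place, and the two other glued pairs
    extend this to the minimum and the maximum.  So every occurrence consists of
    k-3 blocks of one class.  After shifting each interval independently at
    random, q queries see such an occurrence with probability O(eps n (q/n)^(k-3)).

    That most patterns have a wide pair is shown by switching: in a pattern
    without one, moving a high value right behind a low one creates one, in about
    L^2 ways, and each result arises in at most 4k ways. *)

Require Import Defs.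
From HB Require Import structures.
From mathcomp Require Import all_boot all_order all_algebra all_fingroup.
From mathcomp Require Import all_classical all_reals all_analysis.
From mathcomp Require Import measurable_realfun zify ring lra.

Set Implicit Arguments.
Unset Strict Implicit.
Unset Printing Implicit Defensive.

Import Order.TTheory GRing.Theory Num.Theory.
Import numFieldNormedType.Exports.

(** * Rigidity of occurrences *)

(** Strict growth gains at least one per step, so [g x >= x] spreads upwards from [lo] and
    [g x <= x] downwards from [hi]. *)
Lemma increasing_interval_id (g : nat -> nat) (lo hi : nat) :
  (forall x y, lo <= x -> x < y -> y <= hi -> g x < g y) ->
  lo <= g lo -> g hi <= hi ->
  forall x, lo <= x <= hi -> g x = x.
Proof.
move=> g_incr lo_g g_hi x /andP[lo_x x_hi].
have ge_id y : lo + y <= hi -> lo + y <= g (lo + y).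
  elim: y => [|y IHy] y_hi; first by rewrite addn0.
  have := g_incr (lo + y) (lo + y.+1); have := IHy; lia.
have le_id y : lo + y <= hi -> g (hi - y) <= hi - y.
  elim: y => [|y IHy] y_hi; first by rewrite subn0.
  have := g_incr (hi - y.+1) (hi - y); have := IHy; lia.
have := ge_id (x - lo); have := le_id (hi - x).
have -> : hi - (hi - x) = x by lia.
have -> : lo + (x - lo) = x by lia.
lia.
Qed.

Section Rigidity.
Variables (k : nat) (pi : nat -> nat) (w b0 b1 : nat).

(* (b, b.+1) is the glued pair of the entry of value v: this entry and its
   neighbour towards w. *)
Definition anchored (b v : nat) : bool :=
  [&& b.+1 < k, (b.+1 < w) || (w.+1 < b), pi (if b < w then b else b.+1) == v
    & pi w < pi (if b < w then b.+1 else b) < pi w.+1].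

(** [(w, w.+1)] is the wide pair; [b0] and [b1] start the glued pairs of the minimum and the
    maximum. Wideness enters through the inequalities in [anchored]. *)
Record good_pattern : Prop := GoodPattern {
  good_lt : forall a, a < k -> pi a < k;
  good_inj : forall a b, a < k -> b < k -> pi a = pi b -> a = b;
  good_w : w.+1 < k;
  good_min : anchored b0 0;
  good_max : anchored b1 k.-1 }.

Definition paired (c : nat) : bool := [|| c == w, c == b0 | c == b1].

(** The index of the block containing entry [c]: it stays constant exactly across a glued pair. *)
Fixpoint block (c : nat) : nat :=
  if c is c'.+1 then block c' + ~~ paired c' else 0.

Definition descent (c : nat) : bool := pi c.+1 < pi c.

(* Left of w a block runs against the step to the next entry, right of w against
   the step from the previous one, so a block never absorbs that step. *)
Definition block_up (c : nat) : bool :=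
  if paired c then descent c
  else if (0 < c) && paired c.-1 then descent c.-1
  else if c < w then descent c else descent c.-1.

Hypothesis G : good_pattern.
Let pi_lt := good_lt G.
Let pi_inj := good_inj G.
Let wk := good_w G.

Lemma good_lo_hi : pi w < pi w.+1.
Proof. by case/and4P: (good_min G) => _ _ _; lia. Qed.

Lemma paired_lt c : paired c -> c.+1 < k.
Proof.
case/and4P: (good_min G) => ? _ _ _; case/and4P: (good_max G) => ? _ _ _.
by rewrite /paired => /or3P[] /eqP ->.
Qed.

(** If the pairs at [b0] and [b1] overlapped, one extremal entry would be the neighbour of the
    other, but that neighbour has a value strictly inside the wide pair. So blocks have at most two
    entries. *)
Lemma paired_gap c : paired c -> paired c.+1 = false.
Proof.
have := pi_lt (ltnW wk); have := pi_lt wk.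
case/and4P: (good_min G) => ? H0 /eqP + +; case/and4P: (good_max G) => ? H1 /eqP.
have eq01 : b0.+1 = b1 -> pi b0.+1 = pi b1 by move->.
have eq10 : b1.+1 = b0 -> pi b1.+1 = pi b0 by move->.
rewrite /paired; case: (ltnP b0 w) => ?; case: (ltnP b1 w) => ?;
  move=> ? ? ? ? ? ? /or3P[] /eqP ->; apply/negP => /or3P[] /eqP ?; lia.
Qed.

Lemma block_mono : {homo block : c d / c <= d}.
Proof.
move=> c d; elim: d => [|d IHd]; first by rewrite leqn0 => /eqP->.
by rewrite leq_eqVlt => /predU1P[->//|/IHd h] /=; rewrite (leq_trans h) ?leq_addr.
Qed.

Lemma block_eq c d : c < d -> block c = block d -> paired c /\ d = c.+1.
Proof.
move=> cd e.
have pc : paired c by apply: contraT => n; have /= := block_mono cd; rewrite n; lia.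
split=> //; apply/eqP; rewrite eqn_leq cd andbT leqNgt; apply/negP => cd2.
have /= := block_mono cd2; rewrite pc (paired_gap pc); lia.
Qed.

Lemma block_cases c d : block c = block d ->
  [\/ c = d, paired c /\ d = c.+1 | paired d /\ c = d.+1].
Proof.
move=> e; case: (ltngtP c d) => h; first by constructor 2; apply: block_eq.
  by constructor 3; apply: block_eq.
by constructor 1.
Qed.

Lemma block_up_eq c d : block c = block d -> block_up c = block_up d.
Proof.
by case/block_cases => [->//|[p ->]|[p ->]]; rewrite /block_up p (paired_gap p) /= ?p.
Qed.

Lemma block_up_paired c : paired c -> block_up c = descent c.
Proof. by rewrite /block_up => ->. Qed.

Lemma paired_extremal c : paired c -> c != w ->
  let e := if c < w then c else c.+1 in pi e = 0 \/ pi e = k.-1.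
Proof.
case/and4P: (good_min G) => ? ? /eqP ? _; case/and4P: (good_max G) => ? ? /eqP ? _.
by rewrite /paired => /or3P[] /eqP ->; rewrite ?eqxx // => _; [left|right].
Qed.

Lemma block_last : 0 < k -> (block k.-1).+1 + 3 = k.
Proof.
have [d1 [d2 d3]] : b0 <> w /\ b1 <> w /\ b0 <> b1.
  case/and4P: (good_min G) => ? ? /eqP + _; case/and4P: (good_max G) => ? ? /eqP + _.
  by move=> h1 h0; split; [|split]; try lia; move=> e; move: h1 h0; rewrite e; lia.
have H c : block c + ((w < c) + (b0 < c) + (b1 < c)) = c.
  elim: c => [//|c /= IH].
  by rewrite /paired; move: IH; case: eqVneq; case: eqVneq; case: eqVneq; lia.
have := H k.-1.
have := @paired_lt w; have := @paired_lt b0; have := @paired_lt b1.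
rewrite /paired !eqxx ?orbT; lia.
Qed.

(* An occurrence of the pattern: its a-th entry is the copy of entry [c a] in
   the class [t a]. *)
Variables (c t : nat -> nat).
Hypothesis c_lt : forall a, a < k -> c a < k.
Hypothesis c_block : forall a b, a < b -> b < k -> block (c a) <= block (c b).
Hypothesis t_dir : forall a b, a < b -> b < k -> block (c a) = block (c b) ->
  if block_up (c a) then t a <= t b else t b <= t a.
Hypothesis occ : forall a b, a < k -> b < k -> pi a < pi b ->
  t a * k + pi (c a) < t b * k + pi (c b).

(** A class spans a window of [k] values, so values compare first by class, then by entry. *)
Lemma occ_lex a b : a < k -> b < k -> pi a < pi b ->
  t a < t b \/ t a = t b /\ pi (c a) < pi (c b).
Proof.
move=> ak bk /(occ ak bk).
have := pi_lt (c_lt ak); have := pi_lt (c_lt bk).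
case: (ltngtP (t a) (t b)) => [|h|->]; [by left| |right; lia].
have : (t b).+1 * k <= t a * k by rewrite leq_mul2r h orbT.
rewrite mulSn; lia.
Qed.

Lemma occ_t a b : a < k -> b < k -> pi a <= pi b -> t a <= t b.
Proof.
move=> ak bk; rewrite leq_eqVlt => /predU1P[/(pi_inj ak bk)->//|].
by case/(occ_lex ak bk); lia.
Qed.

Lemma occ_c a b : a < k -> b < k -> a <> b -> t a = t b -> c a <> c b.
Proof.
move=> ak bk ab e ec; case: (ltngtP (pi a) (pi b)) => h.
- by have := occ_lex ak bk h; rewrite ec; lia.
- by have := occ_lex bk ak h; rewrite ec; lia.
- exact/ab/pi_inj.
Qed.

(** The block direction orders the two classes against the order of the values, and copies of one
    entry in one class have equal values. *)
Lemma no_merge a x : a.+1 < k -> c a = x -> c a.+1 = x -> block_up x = descent a -> False.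
Proof.
move=> ak ca cb ux.
have := t_dir (ltnSn a) ak; rewrite ca cb ux /descent => /(_ erefl).
case: ltnP => h.
  by have := occ_lex ak (ltnW ak) h; rewrite ca cb; lia.
have ne : pi a <> pi a.+1 by move/pi_inj; lia.
have h' : pi a < pi a.+1 by lia.
by have := occ_lex (ltnW ak) ak h'; rewrite ca cb; lia.
Qed.

(** The block runs against the step, so its direction gives one inequality between the classes and
    the order of the values gives the other. *)
Lemma same_block_t a : a.+1 < k -> block (c a) = block (c a.+1) ->
  block_up (c a) = descent a -> t a = t a.+1.
Proof.
move=> ak e u; have := t_dir (ltnSn a) ak e; rewrite u /descent; case: ltnP => h h'.
  by have := occ_t ak (ltnW ak) (ltnW h); lia.
by have := occ_t (ltnW ak) ak h; lia.
Qed.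

Lemma no_triple a x : a.+2 < k -> paired x ->
  block (c a) = block x -> block (c a.+1) = block x -> block (c a.+2) = block x ->
  t a = t a.+1 -> t a.+1 = t a.+2 -> False.
Proof.
move=> ak px e0 e1 e2 t01 t12.
have n01 : c a <> c a.+1 by apply: occ_c => //; lia.
have n12 : c a.+1 <> c a.+2 by apply: occ_c => //; lia.
have n02 : c a <> c a.+2 by apply: occ_c => //; lia.
have in2 d : block d = block x -> d = x \/ d = x.+1.
  case/block_cases => [->|[p e]|[_ ->]]; [by left| |by right].
  by move: (paired_gap p); rewrite -e px.
by have := in2 _ e0; have := in2 _ e1; have := in2 _ e2; lia.
Qed.

Lemma pi_neq a b : a < k -> b < k -> a <> b -> pi a <> pi b.
Proof. by move=> ak bk n /pi_inj; auto. Qed.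

Lemma block_single x d : ~~ paired x -> ~~ ((0 < x) && paired x.-1) ->
  block d = block x -> d = x.
Proof.
move=> n1 n2 /block_cases[->//|[p e]|[p e]]; last by rewrite p in n1.
by rewrite e /= p in n2.
Qed.

(** The first two entries share a class by [same_block_t]. The third joins them: the block direction
    bounds its class on one side, the extremality of [pi a] on the other. But a block has only two
    entries per class. *)
Lemma extremal_first a x : a.+2 < k -> paired x -> block_up x = descent a ->
  pi a = 0 \/ pi a = k.-1 ->
  block (c a) = block x -> block (c a.+1) = block x -> block (c a.+2) = block x ->
  False.
Proof.
move=> ak px ux ext e0 e1 e2.
have a1k : a.+1 < k by lia.
have a0k : a < k by lia.
have t01 : t a = t a.+1.
  by apply: same_block_t => //; rewrite ?e0 ?e1 // (block_up_eq e0).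
apply: (no_triple ak px e0 e1 e2 t01).
have := t_dir (ltnSn a.+1) ak; rewrite e1 e2 (block_up_eq e1) ux /descent => /(_ erefl).
case: ltnP => hd hdir; have := pi_neq a0k a1k (n_Sn a); have := pi_lt ak; have := pi_lt a1k;
  have := @occ_t a a.+2 a0k ak; have := @occ_t a.+2 a ak a0k;
  by case: ext => h; rewrite h in hd *; lia.
Qed.

Lemma extremal_last a x : a.+2 < k -> paired x -> block_up x = descent a.+1 ->
  pi a.+2 = 0 \/ pi a.+2 = k.-1 ->
  block (c a) = block x -> block (c a.+1) = block x -> block (c a.+2) = block x ->
  False.
Proof.
move=> ak px ux ext e0 e1 e2.
have a1k : a.+1 < k by lia.
have a0k : a < k by lia.
have t12 : t a.+1 = t a.+2.
  by apply: same_block_t => //; rewrite ?e1 ?e2 // (block_up_eq e1).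
apply: (no_triple ak px e0 e1 e2 _ t12).
have := t_dir (ltnSn a) a1k; rewrite e0 e1 (block_up_eq e0) ux /descent => /(_ erefl).
case: ltnP => hd hdir; have := pi_neq a1k ak (n_Sn a.+1); have := pi_lt a0k; have := pi_lt a1k;
  have := @occ_t a.+2 a ak a0k; have := @occ_t a a.+2 a0k ak;
  by case: ext => h; rewrite h in hd *; lia.
Qed.

(** Otherwise [a] and [a.+1] both land in the block of [a]. If that block is single, it runs against
    the step, contrary to [no_merge]. If [a] ends a glued pair, this pair, left of [w], begins with
    its extremal entry, and [extremal_first] excludes a third entry. *)
Lemma block_forward a : a <= w -> block a <= block (c a).
Proof.
elim/ltn_ind: a => -[//|a] IH aw; have ak : a.+1 < k by lia.
have IHa := IH a (ltnSn a) (ltnW aw).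
have mono := c_block (ltnSn a) ak.
rewrite [block a.+1]/=; case: (boolP (paired a)) => pa /=; first by rewrite addn0; lia.
rewrite addn1 ltnNge; apply/negP => le_a1.
have ea : block (c a) = block a by lia.
have ea1 : block (c a.+1) = block a by lia.
case: (boolP ((0 < a) && paired a.-1)) => [/andP[]|nfirst].
  case: a IH aw ak IHa mono pa le_a1 ea ea1 => [//|a] /= IH aw ak IHa mono pa le_a1 ea ea1 _ pa'.
  have eb : block a + ~~ paired a = block a by rewrite pa' addn0.
  rewrite eb in ea ea1.
  have e0 : block (c a) = block a.
    have := c_block (ltnSn a) (ltnW ak); have := IH a; lia.
  apply: (extremal_first ak pa' (block_up_paired pa') _ e0 ea ea1).
  have aw' : a < w by lia.
  by have := paired_extremal pa' ltac:(lia); rewrite aw'.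
apply: (@no_merge a a ak); try exact: block_single.
by rewrite /block_up (negPf pa) (negPf nfirst) aw.
Qed.

(** Mirror image of [block_forward], by induction on the distance [d] to the last entry; right of
    [w] the extremal entry ends its glued pair. *)
Lemma block_backward a : w < a -> a < k -> block (c a) <= block a.
Proof.
move=> wa ak; have [d dE] : exists d, a + d = k.-1 by exists (k.-1 - a); lia.
elim/ltn_ind: d a wa ak dE => -[|d] IH a wa ak dE.
  by rewrite addn0 in dE; apply: block_mono; have := c_lt ak; lia.
have ak1 : a.+1 < k by lia.
have IHa := IH d (ltnSn d) a.+1 (ltnW wa) ak1 ltac:(lia).
have mono := c_block (ltnSn a) ak1.
move: IHa; rewrite [block a.+1]/=; case: (boolP (paired a)) => pa /=.
  by rewrite addn0; lia.
rewrite addn1 => IHa; rewrite leqNgt; apply/negP => le_a1.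
have ba1 : block a.+1 = (block a).+1 by rewrite /= pa addn1.
have ea : block (c a) = block a.+1 by lia.
have ea1 : block (c a.+1) = block a.+1 by lia.
case: (boolP (paired a.+1)) => pa1.
  have ak2 := paired_lt pa1.
  have eb : block a.+2 = block a.+1 by rewrite [LHS]/= pa1 addn0.
  have e2 : block (c a.+2) = block a.+1.
    have h2 := c_block (ltnSn a.+1) ak2.
    case: d IH dE => [|d] IH dE; first by lia.
    by have := IH d (leqnSn _) a.+2; lia.
  apply: (extremal_last ak2 pa1 (block_up_paired pa1) _ ea ea1 e2).
  have aw' : (a.+1 < w) = false by lia.
  by have := paired_extremal pa1 ltac:(lia); rewrite aw'.
have nfirst : ~~ ((0 < a.+1) && paired a.+1.-1) by [].
apply: (@no_merge a a.+1 ak1); try exact: block_single.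
by rewrite /block_up (negPf pa1) (negPf nfirst) (_ : a.+1 < w = false) //; lia.
Qed.

(** The forward bound at [w] and the backward bound at [w.+1] squeeze both entries into the block of
    [w], whose direction forces one class. *)
Lemma pair_pinned : c w = w /\ c w.+1 = w.+1 /\ t w = t w.+1.
Proof.
have pw : paired w by rewrite /paired eqxx.
have bw : block w.+1 = block w by rewrite /= pw addn0.
have h1 := block_forward (leqnn w).
have h2 := block_backward (ltnSn w) wk.
have h3 := c_block (ltnSn w) wk.
have e0 : block (c w) = block w by lia.
have e1 : block (c w.+1) = block w by lia.
have tw : t w = t w.+1.
  by apply: same_block_t => //; rewrite ?e0 ?e1 // (block_up_eq e0) block_up_paired.
have := occ_lex (ltnW wk) wk good_lo_hi; have lohi := good_lo_hi.
have in2 d : block d = block w -> d = w \/ d = w.+1.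
  case/block_cases => [->|[p e]|[_ ->]]; [by left| |by right].
  by move: (paired_gap p); rewrite -e pw.
by case: (in2 _ e0) => ->; case: (in2 _ e1) => ->; lia.
Qed.

(** Here [pos] inverts [pi]. Within one class the map [x -> pi (c (pos x))] is strictly increasing,
    so [increasing_interval_id] applies. *)
Lemma same_class_fixed lo hi :
  (forall x, lo <= x <= hi -> exists2 a, a < k & pi a = x) ->
  (forall a b, a < k -> b < k -> lo <= pi a <= hi -> lo <= pi b <= hi -> t a = t b) ->
  (forall a, a < k -> pi a = lo -> lo <= pi (c a)) ->
  (forall a, a < k -> pi a = hi -> pi (c a) <= hi) ->
  forall a, a < k -> lo <= pi a <= hi -> c a = a.
Proof.
move=> sur teq hlo hhi a ak /[dup] ha /andP[lo_a a_hi].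
pose pos x := find (fun a => pi a == x) (iota 0 k).
have posK x : lo <= x <= hi -> pos x < k /\ pi (pos x) = x.
  case/sur => b bk eb.
  have hs : has (fun a => pi a == x) (iota 0 k).
    by apply/hasP; exists b; rewrite ?mem_iota ?eb.
  have := hs; rewrite has_find size_iota => h; split=> //.
  by have := nth_find 0 hs; rewrite nth_iota // add0n => /eqP.
have hh : lo <= hi by lia.
have [plo elo] := posK lo ltac:(lia); have [phi ehi] := posK hi ltac:(lia).
apply: pi_inj; rewrite ?c_lt //.
have := @increasing_interval_id (fun x => pi (c (pos x))) lo hi _ (hlo _ plo elo)
  (hhi _ phi ehi) (pi a) ha.
have [pa ea] := posK _ ha; rewrite (pi_inj pa ak ea); apply=> x y lx xy yh.
have [px ex] := posK x ltac:(lia); have [py ey] := posK y ltac:(lia).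
have := @occ_lex _ _ px py; rewrite ex ey => /(_ xy) -[|[]//].
by rewrite (teq _ (pos y)) ?ex ?ey; lia.
Qed.

Lemma pi_surj x : x < k -> exists2 a, a < k & pi a = x.
Proof.
move=> xk.
have f_inj : injective (fun a : 'I_k => Ordinal (pi_lt (ltn_ord a))).
  by move=> a b [] /pi_inj e; apply/val_inj/e.
have [g gK Kg] := injF_bij f_inj.
by exists (g (Ordinal xk)); rewrite ?ltn_ord //; have := congr1 val (Kg (Ordinal xk)).
Qed.

Lemma inside_pinned a : a < k -> pi w <= pi a <= pi w.+1 -> c a = a /\ t a = t w.
Proof.
move=> ak ha; have [cw [cw1 tw]] := pair_pinned.
have tE b : b < k -> pi w <= pi b <= pi w.+1 -> t b = t w.
  move=> bk /andP[h1 h2].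
  by have := occ_t (ltnW wk) bk h1; have := occ_t bk wk h2; lia.
split; last exact: tE.
apply: (@same_class_fixed (pi w) (pi w.+1)) => //.
- by move=> x hx; apply: pi_surj; have := pi_lt wk; lia.
- by move=> d e dk ek hd he; rewrite !tE.
- by move=> d dk /pi_inj->; rewrite ?cw // ltnW.
- by move=> d dk /pi_inj->; rewrite ?cw1.
Qed.

(** The neighbour of the extremal entry is pinned by [inside_pinned] and bounds the block of that
    entry on one side; [block_forward] or [block_backward] bounds it on the other. Both then lie in
    one glued block, which runs against its inner step. *)
Lemma anchor_pinned b v : anchored b v -> paired b ->
  t (if b < w then b else b.+1) = t w.
Proof.
case/and4P=> bk bw _ hu pb.
have eb : block b.+1 = block b by rewrite /= pb addn0.
have mono := c_block (ltnSn b) bk.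
case: (ltnP b w) hu => hb hu.
  have [cu tu] := @inside_pinned b.+1 bk ltac:(lia).
  rewrite -tu; have f := block_forward (ltnW hb).
  have e0 : block (c b) = block b by move: mono; rewrite cu; lia.
  by apply: same_block_t => //; rewrite ?cu ?e0 // (block_up_eq e0) block_up_paired.
have [cu tu] := @inside_pinned b (ltnW bk) ltac:(lia).
rewrite -tu; have f := @block_backward b.+1 ltac:(lia) bk.
have e0 : block (c b.+1) = block b by move: mono; rewrite cu; lia.
by apply/esym/same_block_t => //; rewrite cu ?e0 // block_up_paired.
Qed.

(** The minimum and the maximum share the class of [w], and classes are monotone in the value, so
    only one class occurs. *)
Lemma occurrence_rigid a : a < k -> c a = a /\ t a = t w.
Proof.
have tE b : b < k -> t b = t w.
  move=> bk.
  have := anchor_pinned (good_min G); have := anchor_pinned (good_max G).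
  case/and4P: (good_min G) => ? _ /eqP e0 _; case/and4P: (good_max G) => ? _ /eqP e1 _.
  rewrite /paired !eqxx !orbT => /(_ isT) <- /(_ isT) h.
  have l0 : (if b0 < w then b0 else b0.+1) < k by case: ifP; lia.
  have l1 : (if b1 < w then b1 else b1.+1) < k by case: ifP; lia.
  have := @occ_t _ b l0 bk; rewrite e0 => /(_ isT).
  have := @occ_t b _ bk l1; rewrite e1; have := pi_lt bk.
  have := @occ_t _ _ l0 l1; rewrite e0 => /(_ isT).
  have := anchor_pinned (good_max G); rewrite /paired !eqxx !orbT => /(_ isT).
  lia.
move=> ak; split; last exact: tE.
apply: (@same_class_fixed 0 k.-1) => //.
- by move=> x hx; apply: pi_surj; lia.
- by move=> d e dk ek _ _; rewrite !tE.
- by move=> d dk _; have := pi_lt (c_lt dk); lia.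
- by have := pi_lt ak; lia.
Qed.

End Rigidity.

(** * The hard sequences *)

Section HardSequence.
Variables (k : nat) (pi : nat -> nat) (w b0 b1 : nat).
Local Notation paired := (paired w b0 b1).
Local Notation block := (block w b0 b1).
Local Notation block_up := (block_up pi w b0 b1).

Definition block_start (j : nat) : nat := index j [seq block c | c <- iota 0 k].

Definition nblocks : nat := (block k.-1).+1.

Variables (N m : nat) (s : nat -> nat).

(** The last interval absorbs the positions beyond [nblocks * N]. *)
Definition pos_block (x : nat) : nat := minn (x %/ N) nblocks.-1.
(** A proper layer [l] occupies the shifted positions [2l] and [2l+1]. The 2 puts layer 1 at offset
    [s j] of interval [j]; all earlier offsets fall into layer 0. *)
Definition pos_shift (x : nat) : nat := x - pos_block x * N + 2 - s (pos_block x).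
(* Layers 0 and m.+1 are padding: they only show the first entry of a block, so
   no occurrence uses them. *)
Definition pos_layer (x : nat) : nat := minn (pos_shift x)./2 m.+1.
Definition pos_second (x : nat) : bool := odd (pos_shift x) && (0 < pos_layer x < m.+1).
Definition pos_entry (x : nat) : nat :=
  let c := block_start (pos_block x) in if pos_second x && paired c then c.+1 else c.
(** For fixed [j] an involution of [[0, m+1]], used both from layers to classes and back. *)
Definition class_layer (j l : nat) : nat := if block_up (block_start j) then l else m.+1 - l.
Definition pos_class (x : nat) : nat := class_layer (pos_block x) (pos_layer x).
Definition hard_seq (x : nat) : nat := pos_class x * k + pi (pos_entry x).

Hypothesis G : good_pattern k pi w b0 b1.

Lemma block_startP j : j < nblocks ->
  [/\ block_start j < k, block (block_start j) = j
    & forall c, c < block_start j -> block c <> j].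
Proof.
move=> jl; have k0 : 0 < k by have := good_w G; lia.
have onto c : j <= block c -> exists2 d, d <= c & block d = j.
  elim: c => [|c IH] /=; first by rewrite leqn0 => /eqP->; exists 0.
  case: (leqP j (block c)) => [/IH[d dc <-] _|h1 h2]; first by exists d => //; lia.
  by exists c.+1 => //=; lia.
have [c ck cj] := onto k.-1 jl.
have jin : j \in [seq block c | c <- iota 0 k].
  by apply/mapP; exists c => //; rewrite mem_iota; lia.
have h : block_start j < k by rewrite -index_mem size_map size_iota in jin.
split=> //.
  by have := nth_index 0 jin; rewrite (nth_map 0) ?size_iota // nth_iota.
move=> d dj e; have := before_find 0 dj; rewrite (nth_map 0) ?size_iota ?nth_iota; try lia.
by rewrite /= add0n e eqxx.
Qed.

Lemma block_startE a : a < k ->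
  block_start (block a) = if (0 < a) && paired a.-1 then a.-1 else a.
Proof.
move=> ak; have jl : block a < nblocks by rewrite ltnS; apply: block_mono; lia.
have [sk sb smin] := block_startP jl.
case: (block_cases G sb) => [e|[p e]|[p e]].
- case: ifP => // /andP[a0 pa]; case: (smin a.-1); first by rewrite e; lia.
  by rewrite -[in RHS](prednK a0) /= pa addn0.
- set d := block_start (block a) in p e *.
  have [-> a0] : a.-1 = d /\ 0 < a by lia.
  by rewrite a0 p.
- by case: (smin a); rewrite // e.
Qed.

Lemma pos_block_lt x : pos_block x < nblocks.
Proof. by rewrite /pos_block ltnS geq_minr. Qed.

Lemma block_start_paired j : j < nblocks -> paired (block_start j) ->
  (block_start j).+1 < k /\ block (block_start j).+1 = j.
Proof.
by move=> /block_startP[_ e _] p; split; [exact: paired_lt G _ p|rewrite /= p addn0].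
Qed.

Lemma pos_entry_lt x : pos_entry x < k.
Proof.
rewrite /pos_entry; have [h _ _] := block_startP (pos_block_lt x); case: ifP => // /andP[_ p].
by have [] := block_start_paired (pos_block_lt x) p.
Qed.

Lemma block_pos_entry x : block (pos_entry x) = pos_block x.
Proof.
rewrite /pos_entry; have [_ h _] := block_startP (pos_block_lt x); case: ifP => // /andP[_ p].
by have [] := block_start_paired (pos_block_lt x) p.
Qed.

Lemma pos_block_mono x y : x <= y -> pos_block x <= pos_block y.
Proof. by move=> xy; have := leq_div2r N xy; rewrite /pos_block; lia. Qed.

Lemma pos_class_dir x y : x <= y -> pos_block x = pos_block y ->
  if block_up (pos_entry x) then pos_class x <= pos_class y else pos_class y <= pos_class x.
Proof.
move=> xy e.
have -> : block_up (pos_entry x) = block_up (block_start (pos_block x)).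
  apply: (block_up_eq G); have [_ -> _] := block_startP (pos_block_lt x).
  exact: block_pos_entry.
have h : pos_layer x <= pos_layer y.
  rewrite /pos_layer /pos_shift e.
  have h : x - pos_block y * N + 2 - s (pos_block y)
      <= y - pos_block y * N + 2 - s (pos_block y) by lia.
  by have := half_leq h; lia.
by rewrite /pos_class /class_layer e; case: (block_up (block_start _)); lia.
Qed.

Lemma class_layerK j l : l <= m.+1 -> class_layer j (class_layer j l) = l.
Proof. by rewrite /class_layer; case: (block_up _); lia. Qed.

(** Prepares the counting of shifts: one class and, per interval, one position of the occurrence and
    one bit determine [s]. *)
Lemma hard_seq_rigid (idx : nat -> nat) :
  (forall a b, a < b -> b < k -> idx a < idx b) ->
  (forall a b, a < k -> b < k -> pi a < pi b -> hard_seq (idx a) < hard_seq (idx b)) ->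
  exists2 t, t < m.+2 & forall j, j < nblocks ->
    exists2 a, a < k & exists e : bool,
      s j = idx a - j * N + 2 - ((class_layer j t).*2 + e).
Proof.
move=> incr ord.
have rig a : a < k -> pos_entry (idx a) = a /\ pos_class (idx a) = pos_class (idx w).
  apply: (@occurrence_rigid _ _ _ _ _ G (pos_entry \o idx) (pos_class \o idx)) => /=.
  - by move=> b _; exact: pos_entry_lt.
  - by move=> b d bd dk; rewrite !block_pos_entry pos_block_mono // ltnW // incr.
  - move=> b d bd dk; rewrite !block_pos_entry => e.
    by apply: pos_class_dir; rewrite // ltnW // incr.
  - exact: ord.
have wk := good_w G.
exists (pos_class (idx w)).
  by rewrite /pos_class /class_layer; case: ifP => _; rewrite /pos_layer; lia.
(* Padding never shows the second entry of the wide pair, so the common class is a proper one. *)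
have tin : 0 < pos_class (idx w) < m.+1.
  have [e1 <-] := rig _ wk; have [e0 _] := rig _ (ltnW wk).
  have pbw : pos_block (idx w.+1) = block w.+1 by rewrite -block_pos_entry e1.
  have := e1; rewrite /pos_entry pbw block_startE //= /paired eqxx /=.
  case: (boolP (pos_second _)) => [/andP[_ h]|_] /=; last by lia.
  by move=> _; rewrite /pos_class /class_layer; case: ifP => _; lia.
move=> j jl; have [ak bj _] := block_startP jl.
exists (block_start j) => //; set x := idx _.
have [ex tx] := rig _ ak; rewrite -/x in ex tx.
have pbx : pos_block x = j by rewrite -block_pos_entry ex.
(* The bit tells which of the two positions of its layer [x] is. *)
exists (odd (pos_shift x)).
rewrite -tx /pos_class pbx class_layerK; last by rewrite /pos_layer; lia.
have lx : 0 < pos_layer x < m.+1.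
  move: tin; rewrite -tx /pos_class /class_layer; case: ifP => _ //; lia.
have -> : (pos_layer x).*2 + odd (pos_shift x) = pos_shift x.
  have -> : pos_layer x = (pos_shift x)./2 by move: lx; rewrite /pos_layer; lia.
  by rewrite addnC odd_double_half.
(* Positivity rules out truncation in [pos_shift], which can then be solved for [s j]. *)
have : 0 < pos_shift x by move: lx; rewrite /pos_layer; lia.
by rewrite /pos_shift pbx; lia.
Qed.

Hypothesis s_le : forall j, j < nblocks -> s j + m.*2 <= N.

(** Inverts the layout: where interval [block a] shows entry [a] of class [t]. The final 2 cancels
    the offset in [pos_shift]. *)
Definition plant (t a : nat) : nat :=
  block a * N + (s (block a) + (class_layer (block a) t).*2 + ((0 < a) && paired a.-1) - 2).

Lemma plant_spec t a : a < k -> 0 < t < m.+1 ->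
  [/\ plant t a < nblocks * N, pos_entry (plant t a) = a, pos_class (plant t a) = t
    & pos_block (plant t a) = block a].
Proof.
move=> ak t_in; set j := block a; set e := (0 < a) && paired a.-1.
have jl : j < nblocks by rewrite ltnS; apply: block_mono; lia.
have l_in : 0 < class_layer j t < m.+1 by rewrite /class_layer; case: ifP => _; lia.
have sj := s_le jl.
set y := s j + (class_layer j t).*2 + e - 2.
have y_lt : y < N by rewrite /y; lia.
have xE : plant t a = j * N + y by [].
have pb : pos_block (plant t a) = j.
  by rewrite /pos_block xE divnMDl ?divn_small //; [rewrite /nblocks in jl *; lia|lia].
have ps : pos_shift (plant t a) = (class_layer j t).*2 + e.
  by rewrite /pos_shift pb xE addKn /y; lia.
have la : pos_layer (plant t a) = class_layer j t.
  by rewrite /pos_layer ps addnC half_bit_double; lia.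
split=> //; last by rewrite /pos_class pb la class_layerK //; lia.
- rewrite xE (@leq_trans (j.+1 * N)) ?leq_mul2r ?jl ?orbT //.
  by rewrite mulSn addnC ltn_add2r.
- rewrite /pos_entry pb block_startE // /pos_second la l_in andbT ps oddD odd_double /= -/e oddb.
  have [/andP[a0 pa]|ne] := boolP e; last by [].
  by rewrite pa /=; lia.
Qed.

Lemma plant_incr t a b : a < b -> b < k -> 0 < t < m.+1 -> plant t a < plant t b.
Proof.
move=> ab bk t_in.
have [_ _ _ pa] := plant_spec (ltn_trans ab bk) t_in; have [_ _ _ pb] := plant_spec bk t_in.
case: (ltngtP (block a) (block b)) => h; last 1 first.
- have [pa' bE] := block_eq G ab h; rewrite /plant -h ltn_add2l bE /= pa'.
  have na : (0 < a) && paired a.-1 = false.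
    by apply/negP => /andP[a0 /(paired_gap G)]; rewrite prednK // pa'.
  have : 0 < class_layer (block a) t by rewrite /class_layer; case: ifP => _; lia.
  by rewrite na; lia.
- by rewrite ltnNge; apply/negP => /pos_block_mono; rewrite pa pb; lia.
- by have := block_mono w b0 b1 (ltnW ab); lia.
Qed.

End HardSequence.

(** * One-sided tests and occurrences among the queries *)

Local Open Scope classical_set_scope.
Local Open Scope ring_scope.

(** The sum is the expected number of events that occur, and this number is at most [M]
    pointwise. *)
Lemma sum_probability_le (R : realType) (d : measure_display)
    (T : measurableType d) (P : probability T R) (I : finType)
    (E : I -> set T) (M : R) :
  (forall i, measurable (E i)) ->
  (forall w, #|[pred i | `[< E i w >]]|%:R <= M) ->
  (\sum_i P (E i) <= M%:E)%E.
Proof.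
move=> mE leM.
have -> : (\sum_i P (E i) = \int[P]_x \sum_i (\1_(E i) x)%:E)%E.
  rewrite ge0_integral_sum //; last by move=> i; apply/measurable_EFinP.
  by apply: eq_bigr => i _; rewrite integral_indic // setIT.
have intM : (\int[P]_x (M%:E) = M%:E)%E.
  by rewrite integral_cst // [X in (_ * X)%E]probability_setT mule1.
rewrite -[leRHS]intM; apply: ge0_le_integral => //.
- by move=> x _; apply: sume_ge0.
- by apply: emeasurable_sum => i; apply/measurable_EFinP.
move=> x _; rewrite sumEFin lee_fin; apply: le_trans (leM x).
rewrite -sum1_card natr_sum [leRHS]big_mkcond /=; apply: ler_sum => i _.
by rewrite indicE inE; case: asboolP => h; [rewrite mem_set|rewrite memNset].
Qed.

Definition occurs_in (R : realType) (k n : nat) (p : 'S_k) (f : 'I_n -> R)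
    (Q : seq 'I_n) (idx : 'I_k -> 'I_n) : Prop :=
  [/\ forall a, idx a \in Q,
      forall a b : 'I_k, (a < b)%N -> (idx a < idx b)%N
    & forall a b : 'I_k, f (idx a) < f (idx b) <-> (p a < p b)%N].

(** Rounds down to the nearest point of [Q]; points below its least element [q1] go up to [q1]. *)
Lemma monotone_retraction (n : nat) (Q : seq 'I_n) (q0 : 'I_n) : q0 \in Q ->
  exists rep : 'I_n -> 'I_n, [/\ forall x, rep x \in Q, forall q, q \in Q -> rep q = q
    & {homo rep : x y / (x <= y)%N}].
Proof.
move=> q0Q.
case: (@arg_minnP _ q0 (mem Q) val q0Q) => /= q1 q1Q q1min.
pose P x q := (q \in Q) && (q <= maxn (x : 'I_n) q1)%N.
have Pq1 x : P x q1 by rewrite /P; apply/andP; split => //; lia.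
exists (fun x => [arg max_(q > q1 | P x q) val q]%N); split=> [x|q qQ|x y xy].
- by case: arg_maxnP => [|q /andP[]].
- case: arg_maxnP => [|r /andP[rQ r_le] rmax]; first exact: Pq1.
  have q1q := q1min q qQ.
  have qr : (val q <= val r)%N by apply: rmax; rewrite /P qQ; lia.
  by apply/val_inj/eqP; rewrite eqn_leq qr andbT; move: r_le => /=; lia.
- case: arg_maxnP => [|r /andP[rQ r_le] rmax]; first exact: Pq1.
  case: arg_maxnP => [|r' /andP[r'Q r'_le] r'max]; first exact: Pq1.
  by apply: r'max; rewrite /P rQ /=; lia.
Qed.

(** Composing [f] with the retraction onto [Q] keeps the answers. An occurrence in the composite has
    distinct values, hence distinct representatives, and these form an occurrence inside [Q]. *)
Lemma pattern_free_extension (R : realType) (k n : nat) (p : 'S_k)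
    (f : 'I_n -> R) (Q : seq 'I_n) : (1 < k)%N ->
  (forall idx, ~ occurs_in p f Q idx) ->
  exists2 g : 'I_n -> R, pattern_free p g & [seq g i | i <- Q] = [seq f i | i <- Q].
Proof.
move=> k1 nocc.
have pneq (a b : 'I_k) : (a < b)%N -> (p a < p b)%N \/ (p b < p a)%N.
  move=> ab; have : p a != p b by rewrite (inj_eq perm_inj) -val_eqE /= neq_ltn ab.
  by rewrite -val_eqE /= neq_ltn => /orP[]; [left|right].
case: Q nocc => [|q0 Q'] nocc.
  exists (fun=> 0) => // -[idx [_ h]].
  have a01 : (Ordinal (ltnW k1) < Ordinal k1)%N by [].
  by case: (pneq _ _ a01) => /h; rewrite ltxx.
set Q := q0 :: Q' in nocc *.
have [rep [repQ repK rep_mono]] := monotone_retraction (mem_head q0 Q').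
exists (f \o rep); last by apply/eq_in_map => q qQ /=; rewrite repK.
move=> [idx [incr ord]]; apply: (nocc (rep \o idx)); split=> //= a b ab.
have := rep_mono _ _ (ltnW (incr _ _ ab)); rewrite leq_eqVlt => /predU1P[e|//].
have e' := val_inj e.
by case: (pneq _ _ ab) => /ord /=; rewrite e' ltxx.
Qed.

(** Without a visible occurrence the answers are also those of a pattern-free function, which must
    be accepted. *)
Lemma rejection_occurrence (R : realType) (k n : nat) (p : 'S_k) (eps : R)
    (d : measure_display) (T : measurableType d) (P : probability T R)
    (A : nonadaptive_alg R T n) (f : 'I_n -> R) (w : T) :
  (1 < k)%N -> one_sided_test p eps P A -> ~~ accepts A f w ->
  exists idx, occurs_in p f (queries A w) idx.
Proof.
move=> k1 [accept_free _] rej; apply: contrapT => nocc.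
have [|g g_free gE] := @pattern_free_extension _ _ _ p f (queries A w) k1.
  by move=> idx occ; apply: nocc; exists idx.
by have := accept_free g g_free w; rewrite /accepts gE -/(accepts A f w) (negPf rej).
Qed.

Definition ext_nat (k : nat) (u : 'I_k -> nat) (a : nat) : nat :=
  oapp u 0%N (insub a).

Lemma ext_natE (k : nat) (u : 'I_k -> nat) (i : 'I_k) : ext_nat u i = u i.
Proof. by rewrite /ext_nat valK. Qed.

Lemma ext_natP (k : nat) (u : 'I_k -> nat) (a : nat) (ak : (a < k)%N) :
  ext_nat u a = u (Ordinal ak).
Proof. by rewrite -(ext_natE u (Ordinal ak)). Qed.

(** * Distance to freeness and averaging over shifts *)

Section HardFunction.
Variables (R : realType) (k : nat) (p : 'S_k) (w b0 b1 : nat).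
Local Notation pv := (ext_nat (fun i : 'I_k => p i : nat)).
Hypothesis G : good_pattern k pv w b0 b1.
Variables (n N m S : nat).
Local Notation l := (nblocks k w b0 b1).
Local Notation shift := {ffun 'I_l -> 'I_S.+1}.

Definition hard_fun (s : shift) (x : 'I_n) : R :=
  (hard_seq k pv w b0 b1 N m (ext_nat (fun j => s j : nat)) x)%:R.

(** [Phi] decodes a bad shift vector from the class of an occurrence and, per interval, a queried
    position and a bit. *)
Lemma card_bad_shifts (Q : seq 'I_n) :
  (#|[pred s : shift | `[< exists idx, occurs_in p (hard_fun s) Q idx >]]|
     <= m.+2 * (size Q * 2) ^ l)%N.
Proof.
pose Phi (th : 'I_m.+2 * {ffun 'I_l -> 'I_(size Q) * bool}) : shift :=
  [ffun j => inord (tnth (in_tuple Q) (th.2 j).1 - j * N + 2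
    - ((class_layer k pv w b0 b1 m j th.1).*2 + (th.2 j).2))%N].
have -> : (m.+2 * (size Q * 2) ^ l)%N =
    #|{: 'I_m.+2 * {ffun 'I_l -> 'I_(size Q) * bool}}|.
  by rewrite card_prod card_ffun card_prod !card_ord card_bool.
apply: leq_trans (leq_image_card Phi predT); apply/subset_leq_card/fintype.subsetP => s.
rewrite inE => -[idx [idxQ incr ord]].
have [||t tm H] := @hard_seq_rigid _ _ _ _ _ N m (ext_nat (fun j => s j : nat)) G
    (ext_nat (fun a => idx a : nat)).
- move=> a b ab bk; rewrite (ext_natP _ (ltn_trans ab bk)) (ext_natP _ bk).
  exact: incr.
- move=> a b ak bk; rewrite !(ext_natP _ ak) !(ext_natP _ bk) => h.
  by have /ord := h; rewrite /hard_fun ltr_nat.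
have /fin_all_exists[h hE] (j : 'I_l) : exists y : 'I_(size Q) * bool,
    s j = (tnth (in_tuple Q) y.1 - j * N + 2
      - ((class_layer k pv w b0 b1 m j t).*2 + y.2))%N :> nat.
  have [a ak [e]] := H j (ltn_ord j); rewrite ext_natE (ext_natP _ ak) => ->.
  have iQ : (index (idx (Ordinal ak)) Q < size Q)%N by rewrite index_mem.
  exists (Ordinal iQ, e) => /=; rewrite (tnth_nth (idx (Ordinal ak))) /=.
  by rewrite nth_index.
apply/fintype.imageP; exists (Ordinal tm, [ffun j => h j]) => //.
apply/ffunP => j; rewrite ffunE ffunE /= -hE; apply: val_inj.
by rewrite /= inordK.
Qed.

Hypothesis S_le : (S + m.*2 <= N)%N.
Hypothesis N_le : (l * N <= n)%N.

(** Each of the [m] proper classes contains a planted occurrence, and a position has only one class;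
    so destroying all of them takes [m] distinct changes. *)
Lemma hard_fun_far (s : shift) (eps : R) : eps * n%:R < m%:R ->
  eps_far p eps (hard_fun s).
Proof.
move=> epsm g g_free; apply: lt_le_trans epsm _; rewrite ler_nat.
set sn := ext_nat (fun j => s j : nat).
have s_le j : (j < l)%N -> (sn j + m.*2 <= N)%N.
  by move=> jl; rewrite /sn (ext_natP _ jl); have := ltn_ord (s (Ordinal jl)); lia.
pose cl (x : nat) := pos_class k pv w b0 b1 N m sn x.
have /fin_all_exists[h hE] (t : 'I_m) :
    exists i : 'I_n, hard_fun s i != g i /\ cl i = t.+1.
  (* If [g] left class [t.+1] untouched, its planted occurrence would survive. *)
  apply: contrapT => /forallNP none; apply: g_free.
  have t_in : (0 < t.+1 < m.+1)%N by have := ltn_ord t; lia.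
  have plP (a : 'I_k) := plant_spec G s_le (ltn_ord a) t_in.
  have pl_lt (a : 'I_k) : (plant k pv w b0 b1 N m sn t.+1 a < n)%N.
    by have [h _ _ _] := plP a; apply: leq_trans h N_le.
  have gE a : g (Ordinal (pl_lt a)) = (t.+1 * k + p a)%:R.
    have [_ e1 e2 _] := plP a.
    have <- : hard_fun s (Ordinal (pl_lt a)) = g (Ordinal (pl_lt a)).
      by apply/eqP; apply: contrapT => /negP ne; apply: (none (Ordinal (pl_lt a))).
    by rewrite /hard_fun /hard_seq -/sn /= e1 e2 ext_natE.
  exists (fun a => Ordinal (pl_lt a)); split=> [a b ab|a b].
    exact: (plant_incr G s_le).
  by rewrite !gE ltr_nat ltn_add2l.
have h_inj : injective h.
  by move=> t u e; apply: val_inj; have [_] := hE t; have [_] := hE u; rewrite e => -> [].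
rewrite -[leqLHS](card_ord m) -(card_codom h_inj).
by apply/subset_leq_card/fintype.subsetP => i /codomP[t ->]; have [] := hE t.
Qed.

(** Sums the rejection probabilities over all shift vectors: each is at least 2/3, while each random
    outcome rejects only shifts counted by [card_bad_shifts]. *)
Lemma test_size_bound (eps : R) (d : measure_display) (T : measurableType d)
    (P : probability T R) (A : nonadaptive_alg R T n) (B : R) :
  eps * n%:R < m%:R -> one_sided_test p eps P A ->
  (forall x, (size (queries A x))%:R <= B) ->
  2 / 3 * S.+1%:R ^+ l <= m.+2%:R * (B * 2) ^+ l.
Proof.
move=> epsm tst leB; have k1 : (1 < k)%N by have := good_w G; lia.
pose E (s : shift) := [set x : T | ~~ accepts A (hard_fun s) x].
have mE s : measurable (E s).
  rewrite (_ : E s = ~` [set x | accepts A (hard_fun s) x]).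
    exact/measurableC/(measurable_decide A).
  by apply/seteqP; split=> x /= /negP.
have le1 : (\sum_s P (E s) <= (m.+2%:R * (B * 2) ^+ l)%:E)%E.
  apply: sum_probability_le => // x.
  apply: (@le_trans _ _ ((m.+2 * (size (queries A x) * 2) ^ l)%:R)).
    rewrite ler_nat; apply: leq_trans (card_bad_shifts (queries A x)).
    apply/subset_leq_card/fintype.subsetP => s; rewrite !inE => rej.
    exact: rejection_occurrence k1 tst rej.
  rewrite natrM natrX natrM ler_wpM2l // lerXn2r ?nnegrE ?mulr_ge0 //.
    exact: le_trans (leB x).
  by rewrite ler_wpM2r.
rewrite -lee_fin; apply: le_trans le1.
have -> : ((2 / 3 * S.+1%:R ^+ l)%:E = \sum_(s : shift) (2 / 3 : R)%:E)%E.
  by rewrite sumEFin sumr_const card_ffun !card_ord -(mulr_natr (2 / 3)) natrX.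
apply: lee_sum => s _; have [_ rej] := tst; apply: rej.
exact: hard_fun_far.
Qed.

End HardFunction.

(** * The lower bound for good patterns *)

Lemma powR_root_expr (R : realType) (l : nat) (x : R) : (0 < l)%N -> 0 < x ->
  (x `^ (- (1 / l%:R))) ^+ l = x^-1 /\ (x `^ (1 - 1 / l%:R)) ^+ l = x ^+ l / x.
Proof.
move=> l0 x0; have lr : l%:R != 0 :> R by rewrite pnatr_eq0 -lt0n.
split; rewrite -powR_mulrn ?powR_ge0 // -powRrM.
  have -> : - (1 / l%:R) * l%:R = -1 :> R by field.
  by rewrite powR_inv1 // ltW.
have -> : (1 - 1 / l%:R) * l%:R = l%:R - 1 :> R by field.
by rewrite powRB ?powRr1 ?powR_mulrn ?ltW // (gt_eqF x0) implybT.
Qed.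

Lemma good_pattern_Omega (R : realType) (k : nat) (p : 'S_k) (w b0 b1 : nat) :
  good_pattern k (ext_nat (fun i : 'I_k => p i : nat)) w b0 b1 ->
  nonadaptive_one_sided_Omega p (fun (eps : R) (n : nat) =>
    eps `^ (- (1 / (k%:R - 3))) * n%:R `^ (1 - 1 / (k%:R - 3))).
Proof.
move=> G; set l := nblocks k w b0 b1.
have lE : (l + 3 = k)%N by apply: (block_last G); have := good_w G; lia.
have l0 : (0 < l)%N by [].
have -> : k%:R - 3 = l%:R :> R by rewrite -lE natrD addrK.
have lr : 0 < l%:R :> R by rewrite ltr0n.
have lr0 : l%:R != 0 :> R by rewrite gt_eqF.
(* [eps0] lets the [2m] positions of the layers fit into an interval and leaves [S.+1 >= n/(2l)]
   shifts; [c] is fitted to the count of bad shifts. *)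
exists (1 / (32 * l%:R)), (1 / (10 * l%:R)); split; [by rewrite divr_gt0 ?mulr_gt0..|].
move=> eps n /andP[eps0 eps_le] en1 d T P A tst; rewrite leNgt; apply/negP => lt_qc.
set B := (1 / _ * _) in lt_qc.
have leB x : (size (queries A x))%:R <= B.
  rewrite -lee_fin; apply: le_trans (ltW lt_qc).
  by apply: ereal_sup_ubound; exists x.
have n0 : 0 < n%:R :> R by rewrite -(pmulr_rgt0 _ eps0); apply: lt_le_trans en1.
(* The least integer above [eps * n]: enough classes for farness, yet [m + 2 <= 4 * eps * n]. *)
pose m := (Num.truncn (eps * n%:R)).+1.
have m_gt : eps * n%:R < m%:R by rewrite truncnS_gt.
have m_le : m%:R <= eps * n%:R + 1.
  by rewrite -natr1 lerD2r truncn_le // mulr_ge0 // ltW.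
pose N := (n %/ l)%N.
have N_gt : n%:R / l%:R < N%:R + 1 :> R.
  by rewrite ltr_pdivrMr // natr1 -natrM ltr_nat ltn_ceil.
have en_le : eps * n%:R <= n%:R / l%:R / 10.
  have -> : n%:R / l%:R / 10 = 1 / (10 * l%:R) * n%:R :> R by field.
  by rewrite ler_pM2r.
have mN : (m.*2 <= N)%N.
  rewrite -ltnS -(ltr_nat R) -[N.+1%:R]natr1 -muln2 natrM.
  move: N_gt m_le en_le en1; set u := n%:R / l%:R; set v := eps * n%:R; lra.
pose S := (N - m.*2)%N.
have S_le : (S + m.*2 <= N)%N by rewrite subnK.
have N_le : (l * N <= n)%N by rewrite mulnC leq_divM.
have S_gt : n%:R / l%:R / 2 <= S.+1%:R :> R.
  rewrite -(natr1 S) natrB // -muln2 natrM.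
  move: N_gt m_le en_le en1; set u := n%:R / l%:R; set v := eps * n%:R; lra.
have := test_size_bound G S_le N_le m_gt tst leB.
apply/negP; rewrite -ltNge -/l.
(* A lower bound for the number of shift vectors. *)
pose X : R := (n%:R / l%:R / 2) ^+ l.
have X0 : 0 < X by rewrite exprn_gt0 // !divr_gt0.
apply: (@lt_le_trans _ _ (2 / 3 * X)); last first.
  by rewrite ler_pM2l ?lerXn2r ?nnegrE //; lra.
have BE : (B * 2) ^+ l = X / 8 ^+ l * (eps * n%:R)^-1.
  have [e1 _] := powR_root_expr l0 eps0; have [_ e2] := powR_root_expr l0 n0.
  rewrite /B /X !exprMn e1 e2 !exprVn !exprMn expr1n.
  (* One factor 2 pays for [B * 2], one for the 2 inside [X]; the 8 remains as slack. *)
  have -> : 32 = 8 * 2 * 2 :> R by ring.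
  have := expf_neq0 l lr0.
  have : 8 ^+ l != 0 :> R by rewrite expf_neq0.
  have : 2 ^+ l != 0 :> R by rewrite expf_neq0.
  rewrite !exprMn; move: (2 ^+ l) (8 ^+ l) (l%:R ^+ l) (n%:R ^+ l) => x y z u x0 y0 z0.
  by field; rewrite x0 y0 z0 !gt_eqF.
have m4 : m.+2%:R <= 4 * (eps * n%:R).
  by rewrite -(natr1 m.+1) -(natr1 m); move: m_le en1; set v := eps * n%:R; lra.
apply: (@le_lt_trans _ _ (4 * (eps * n%:R) * (B * 2) ^+ l)).
  by rewrite ler_wpM2r // BE ltW //; rewrite !(mulr_gt0, invr_gt0, exprn_gt0).
rewrite BE; have v0 : eps * n%:R != 0 by rewrite mulf_neq0 ?gt_eqF.
have -> : 4 * (eps * n%:R) * (X / 8 ^+ l * (eps * n%:R)^-1) = 4 / 8 ^+ l * X.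
  by field; rewrite expf_neq0 // !gt_eqF.
rewrite ltr_pM2r // ltr_pdivrMr ?exprn_gt0 //.
(* As [l >= 1], the factor [4 / 8^l] is at most 1/2, below 2/3. *)
have : 8 <= 8 ^+ l :> R by rewrite -[leLHS]expr1 ler_weXn2l // ler1n.
lra.
Qed.

(** * Random patterns *)

Lemma card_fibers (A B : finType) (P : pred A) (Q : A -> pred B) :
  #|[pred t : A * B | P t.1 && Q t.1 t.2]| = (\sum_(a | P a) #|Q a|)%N.
Proof.
rewrite -sum1_card (eq_bigl (fun t : A * B => P t.1 && Q t.1 t.2)) //.
rewrite -(pair_big_dep P Q (fun _ _ => 1%N)) /=.
by apply: eq_bigr => a _; rewrite sum1_card.
Qed.

Lemma card_exists_le (A B : finType) (V : pred B) (Q : B -> pred A) :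
  (#|[pred a | [exists (b | V b), Q b a]]| <= \sum_(b | V b) #|Q b|)%N.
Proof.
rewrite -card_fibers.
pose f (t : B * A) := t.2.
apply: leq_trans (leq_image_card f _); apply/subset_leq_card/fintype.subsetP => a.
rewrite inE => /existsP[b /andP[Vb Qba]].
by apply/fintype.imageP; exists (b, a) => //; rewrite inE /= Vb.
Qed.

Lemma card_orb_le (A : finType) (P Q : pred A) :
  (#|[pred a | P a || Q a]| <= #|P| + #|Q|)%N.
Proof. by rewrite -cardUI; exact: leq_addr. Qed.

Lemma card_ord_interval (k a b : nat) : (b <= k)%N ->
  #|[pred z : 'I_k | a <= z < b]%N| = (b - a)%N.
Proof.
move=> bk; rewrite -sum1_card.
rewrite -(big_ord_widen_cond k (fun i => a <= i)%N (fun=> 1%N) bk).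
by rewrite -(big_geq_mkord a b xpredT (fun=> 1%N)) sum_nat_const_nat muln1.
Qed.

Definition adjacent (k : nat) (p : 'S_k) (x z : 'I_k) : bool :=
  let q := (p^-1)%g in ((q z == (q x).+1 :> nat) || (q x == (q z).+1 :> nat))%N.

(** Swapping the values [z] and [z'] shows that the count is the same for all [z != x]; and each
    permutation gives [x] at most two neighbours. *)
Lemma card_adjacent (k : nat) (x z : 'I_k) : x != z ->
  (k.-1 * #|[pred p : 'S_k | adjacent p x z]| <= 2 * #|{: 'S_k}|)%N.
Proof.
move=> xz.
have same z' : z' != x -> #|[pred p : 'S_k | adjacent p x z]| =
    #|[pred p : 'S_k | adjacent p x z']|.
  move=> z'x; rewrite -(fintype.card_image (@mulIg _ (tperm z z'))).
  apply: eq_card => q; apply/fintype.imageP/idP => [[p] + ->|].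
    by rewrite !inE /adjacent !invMg tpermV !permM tpermR tpermD // eq_sym.
  rewrite !inE => adj; exists (q * tperm z z')%g; last by rewrite -mulgA tperm2 mulg1.
  by rewrite !inE /adjacent !invMg tpermV !permM tpermL tpermD // eq_sym.
have -> : (k.-1 * #|[pred p : 'S_k | adjacent p x z]| =
    \sum_(z' | z' != x) #|[pred p : 'S_k | adjacent p x z']|)%N.
  rewrite -(eq_bigr _ same) sum_nat_const; congr (_ * _)%N.
  by rewrite -[in LHS](card_ord k) (cardC1 x).
have -> : (\sum_(z' | z' != x) #|[pred p : 'S_k | adjacent p x z']| =
    \sum_(p : 'S_k) #|[pred z' | z' != x & adjacent p x z']|)%N.
  under eq_bigr do rewrite -sum1_card big_mkcond.
  rewrite exchange_big; apply: eq_bigr => p _ /=.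
  by rewrite -sum1_card [RHS]big_mkcondr.
rewrite mulnC -sum_nat_const; apply: leq_sum => p _.
pose q := (p^-1)%g.
have le1 (c : nat) (f : nat -> nat) : injective f ->
    (#|[pred z' | f (q z') == c]| <= 1)%N.
  move=> f_inj; apply/fintype.card_le1_eqP => y1 y2; rewrite !inE => /eqP <- /eqP /f_inj.
  by move/val_inj/perm_inj.
apply: (@leq_trans (#|[pred z' | id (q z' : nat) == (q x).+1]|
    + #|[pred z' | (q z').+1 == q x]|)).
  rewrite -cardUI; apply: leq_trans (leq_addr _ _).
  apply/subset_leq_card/fintype.subsetP => z'; rewrite !inE /adjacent -/q => /andP[_].
  by rewrite [q x == _ :> nat]eq_sym.
apply: (@leq_add _ _ 1 1); [exact: (le1 _ id (fun _ _ => id))|exact: (le1 _ S succn_inj)].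
Qed.

Section RandomPattern.
Variables (k L : nat).
Hypothesis Lk : (L.*2 + 2 < k)%N.

Definition outer : pred 'I_k := [pred z : 'I_k | (z <= L) || (k.-1 - L <= z)]%N.
(** Leaving out 0 here and [k.-1] in [high] keeps the minimum and the maximum out of the wide
    pair. *)
Definition low : pred 'I_k := [pred z : 'I_k | 1 <= z < L.+1]%N.
Definition high : pred 'I_k := [pred z : 'I_k | k.-1 - L <= z < k.-1]%N.

Definition outer_nbr (p : 'S_k) : bool :=
  [exists xz : 'I_k * 'I_k,
    ((xz.1 == 0 :> nat) || (xz.1 == k.-1 :> nat)) && outer xz.2 && (xz.1 != xz.2)
    && adjacent p xz.1 xz.2].

(** The starting positions of candidates for the wide pair. *)
Definition jump (p : 'S_k) : pred 'I_k :=
  [pred q : 'I_k | [exists q' : 'I_k, (q' == q.+1 :> nat) && (p q \in low) && (p q' \in high)]].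

Definition no_jump (p : 'S_k) : bool := #|jump p| == 0%N.

Lemma card_outer : (#|outer| <= (L.+1).*2)%N.
Proof.
apply: (@leq_trans (#|[pred z : 'I_k | 0 <= z < L.+1]|
    + #|[pred z : 'I_k | k.-1 - L <= z < k]|)%N).
  rewrite -cardUI; apply: leq_trans (leq_addr _ _).
  apply/subset_leq_card/fintype.subsetP => z; rewrite !inE ltn_ord andbT.
  by rewrite ltnS.
by rewrite !card_ord_interval //; lia.
Qed.

(** Union bound over two extremal values and at most [2(L+1)] outer ones, each pair having
    probability at most [2/(k-1)]. *)
Lemma card_outer_nbr :
  (k.-1 * #|[pred p | outer_nbr p]| <= 8 * L.+1 * #|{: 'S_k}|)%N.
Proof.
pose V : pred ('I_k * 'I_k) :=
  [pred xz : 'I_k * 'I_k | ((xz.1 == 0 :> nat) || (xz.1 == k.-1 :> nat)) && outer xz.2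
    && (xz.1 != xz.2)].
have cardV : (#|V| <= 4 * L.+1)%N.
  apply: (@leq_trans (#|[pred t : 'I_k * 'I_k |
      ((t.1 == 0 :> nat) || (t.1 == k.-1 :> nat)) && outer t.2]|)%N).
    by apply/subset_leq_card/fintype.subsetP => t; rewrite !inE => /andP[].
  rewrite (card_fibers (fun x : 'I_k => (x == 0 :> nat) || (x == k.-1 :> nat))
    (fun=> outer)) sum_nat_const.
  have -> : (4 * L.+1 = 2 * (L.+1).*2)%N by lia.
  apply: leq_mul card_outer.
  apply: (@leq_trans (#|[pred z : 'I_k | 0 <= z < 1]|
    + #|[pred z : 'I_k | k.-1 <= z < k]|)%N).
    rewrite -cardUI; apply: leq_trans (leq_addr _ _).
    apply/subset_leq_card/fintype.subsetP => z; rewrite !inE ltn_ord andbT.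
    by case/orP=> /eqP ->; rewrite ?leqnn ?orbT.
  by rewrite !card_ord_interval //; lia.
apply: (@leq_trans (k.-1 * \sum_(xz | V xz) #|[pred p | adjacent p xz.1 xz.2]|)%N).
  by rewrite leq_mul2l; apply/orP; right; exact: card_exists_le.
rewrite big_distrr /=.
apply: (@leq_trans (\sum_(xz | V xz) 2 * #|{: 'S_k}|)%N).
  by apply: leq_sum => xz /andP[_ ne]; exact: card_adjacent.
rewrite sum_nat_const mulnA leq_mul2r; apply/orP; right.
by move: cardV; rewrite (_ : #|V| = #|[pred x | V x]|) //; lia.
Qed.

Lemma low_high (x y : 'I_k) : x \in low -> y \in high -> x != y.
Proof. by rewrite !inE -val_eqE /=; lia. Qed.

(** * Switchings and patterns without a jump *)

Section Switching.
Variables (p : 'S_k) (q' r : 'I_k).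
Let p' := (p * tperm (p q') (p r))%g.

Lemma switchE i : i != q' -> i != r -> p' i = p i.
Proof.
move=> iq ir; rewrite /p' permM tpermD // inj_eq ?(eq_sym _ i) //; exact: perm_inj.
Qed.

Lemma switch_q' : p' q' = p r.
Proof. by rewrite /p' permM tpermL. Qed.

Lemma switch_r : p' r = p q'.
Proof. by rewrite /p' permM tpermR. Qed.

(** As [p] has no jump, each jump of [p'] starts or ends at a changed position, [q'] or [r]. *)
Lemma switch_jump_le4 : no_jump p -> (#|jump p'| <= 4)%N.
Proof.
move=> /eqP/card0_eq nj.
have sub : {subset jump p' <=
    [pred i : 'I_k | (i \in [:: q'; r]) || (i.+1 \in [:: val q'; val r])]}.
  move=> i; rewrite !inE => /existsP[i' /andP[/andP[/eqP ii' lo] hi]].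
  apply: contraT; rewrite !negb_or => /andP[/andP[n1 n2] /andP[n3 n4]].
  have := nj i; rewrite !inE => /negbT/negP[]; apply/existsP; exists i'.
  rewrite ii' eqxx /= -(switchE n1 n2) lo -(@switchE i') //.
    by rewrite -val_eqE /= ii'.
  by rewrite -val_eqE /= ii'.
apply: leq_trans; first by apply: subset_leq_card; apply/fintype.subsetP; exact: sub.
have le1 (c : nat) (f : nat -> nat) : injective f ->
    (#|[pred i : 'I_k | f i == c]| <= 1)%N.
  move=> f_inj; apply/fintype.card_le1_eqP => y1 y2; rewrite !inE => /eqP <- /eqP /f_inj.
  by move/val_inj.
apply: (leq_trans (card_orb_le _ _)); apply: (@leq_add _ _ 2 2).
  rewrite (_ : #|_| = #|[pred i : 'I_k | (i == q') || (i == r)]|); last first.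
    by apply: eq_card => i; rewrite !inE.
  apply: (leq_trans (card_orb_le _ _)); apply: (@leq_add _ _ 1 1).
    exact: (le1 q' id (fun _ _ => id)).
  exact: (le1 r id (fun _ _ => id)).
rewrite (_ : #|_| = #|[pred i : 'I_k | (i.+1 == q' :> nat) || (i.+1 == r :> nat)]|); last first.
  by apply: eq_card => i; rewrite !inE unfold_in !inE.
apply: (leq_trans (card_orb_le _ _)); apply: (@leq_add _ _ 1 1).
  exact: (le1 q' S succn_inj).
exact: (le1 r S succn_inj).
Qed.
End Switching.

Lemma card_preim_perm (p : 'S_k) (A : pred 'I_k) : #|[pred r | p r \in A]| = #|A|.
Proof.
rewrite -(fintype.card_image (@perm_inj _ p)); apply: eq_card => x.
apply/fintype.imageP/idP => [[r rA ->]|xA]; first by rewrite inE in rA.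
by exists (p^-1 x)%g; rewrite ?inE permKV.
Qed.

(** At most one of the [L] low values stands last and so has no successor. *)
Lemma card_switchings (p : 'S_k) :
  (L.-1 * L <= #|[pred t : 'I_k * 'I_k |
    [&& p t.1 \in low, t.1.+1 < k & p t.2 \in high]]|)%N.
Proof.
have -> : #|[pred t : 'I_k * 'I_k | [&& p t.1 \in low, t.1.+1 < k & p t.2 \in high]]|%N =
    (#|[pred q : 'I_k | (p q \in low) && (q.+1 < k)]| * L)%N.
  rewrite (eq_card (B := [pred t : 'I_k * 'I_k |
    ((p t.1 \in low) && (t.1.+1 < k)%N) && (p t.2 \in high)])); last first.
    by move=> t; rewrite !inE andbA.
  rewrite (card_fibers (fun q : 'I_k => (p q \in low) && (q.+1 < k)%N)
    (fun=> [pred r | p r \in high])) sum_nat_const card_preim_perm.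
  by congr (_ * _)%N; rewrite card_ord_interval; lia.
rewrite leq_mul2r; apply/orP; right.
have : #|[pred q | p q \in low]| = L.
  by rewrite card_preim_perm card_ord_interval; lia.
have last1 := @card_ord_interval k k.-1 k (leqnn k).
have : (#|[pred q | p q \in low]| <= #|[pred q : 'I_k | (p q \in low) && (q.+1 < k)]|
   + #|[pred q : 'I_k | k.-1 <= q < k]|)%N.
  apply: leq_trans (card_orb_le _ _).
  apply/subset_leq_card/fintype.subsetP => q; rewrite !inE => -> /=.
  by have := ltn_ord q; lia.
by rewrite last1; lia.
Qed.

(** Double counting: [Psi] swaps the high value at [r] to the place behind the low value at [q],
    making [q] a jump. It is injective, and a result allows at most 4 choices of [q] and [k] of
    [r]. *)
Lemma card_no_jump :
  (#|[pred p | no_jump p]| * (L.-1 * L) <= #|{: 'S_k}| * (4 * k))%N.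
Proof.
pose Q (p : 'S_k) : pred ('I_k * 'I_k) :=
  [pred t | [&& p t.1 \in low, t.1.+1 < k & p t.2 \in high]]%N.
pose Dom := [pred t : 'S_k * ('I_k * 'I_k) | no_jump t.1 && Q t.1 t.2].
pose Cod := [pred t : 'S_k * ('I_k * 'I_k) | (#|jump t.1| <= 4)%N && jump t.1 t.2.1].
pose Psi (t : 'S_k * ('I_k * 'I_k)) : 'S_k * ('I_k * 'I_k) :=
  ((t.1 * tperm (t.1 (ordS t.2.1)) (t.1 t.2.2))%g, t.2).
(* [ordS] is cyclic; the condition in [Q] excludes the wrap-around. *)
have ordSE (q : 'I_k) : (q.+1 < k)%N -> ordS q = q.+1 :> nat.
  by move=> h; rewrite /= modn_small.
have DomE : (#|[pred p | no_jump p]| * (L.-1 * L) <= #|Dom|)%N.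
  rewrite (card_fibers no_jump Q) -sum_nat_const.
  by apply: leq_sum => p _; exact: card_switchings.
have CodE : (#|Cod| <= #|{: 'S_k}| * (4 * k))%N.
  rewrite (card_fibers (fun p => #|jump p| <= 4)%N
    (fun p => [pred t : 'I_k * 'I_k | jump p t.1])).
  rewrite -sum_nat_const [leqLHS]big_mkcond /=; apply: leq_sum => p _.
  case: ifP => // le4.
  rewrite (eq_card (B := [pred t : 'I_k * 'I_k | jump p t.1 && true])); last first.
    by move=> t; rewrite !inE andbT.
  rewrite (card_fibers (jump p) (fun=> predT)) sum_nat_const card_ord.
  by rewrite leq_mul2r; apply/orP; right.
apply: (leq_trans DomE); apply: leq_trans CodE.
rewrite -(@fintype.card_in_image _ _ Psi Dom).
  apply/subset_leq_card/fintype.subsetP => _ /fintype.imageP[[p [q r]]] + ->.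
  rewrite !inE /= => /andP[nj /and3P[lo qk hi]].
  have e := ordSE q qk; rewrite (switch_jump_le4 _ _ nj) /=.
  apply/existsP; exists (ordS q); rewrite switch_q' hi andbT.
  apply/andP; split; first by apply/eqP.
  rewrite switchE ?inE //; first by apply/eqP => /(congr1 val) /= h; move: e => /=; lia.
  by apply: contraTneq hi => <-; apply/negP => /(low_high lo)/eqP.
move=> [p1 [q1 r1]] [p2 [q2 r2]] _ _ [].
set q' := ordS q1 => e eq er; subst q2 r2; congr (_, _).
(* The two swapped values can be read off the result, so the swap can be undone. *)
have er : p1 (ordS q1) = p2 (ordS q1).
  by rewrite -(switch_r p1 (ordS q1) r1) e switch_r.
have eq : p1 r1 = p2 r1.
  by rewrite -(switch_q' p1 (ordS q1) r1) e switch_q'.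
by move: e; rewrite /q' er eq; exact: mulIg.
Qed.

(** The value [x] stands at [e], outside the wide pair. Its neighbour towards [q] is not outer, so
    its value lies strictly inside the wide pair. The glued pair starts at [e] left of [q] and at
    [e.-1] right of it. *)
Lemma anchor_exists (p : 'S_k) (q q' x : 'I_k) :
  q' = q.+1 :> nat -> p q \in low -> p q' \in high ->
  (x == 0 :> nat) || (x == k.-1 :> nat) ->
  (forall z, outer z -> x != z -> ~~ adjacent p x z) ->
  exists b, anchored k (ext_nat (fun i : 'I_k => p i : nat)) q b x.
Proof.
move=> qq' lo hi xE nadj; set pv := ext_nat _.
pose e := (p^-1 x)%g.
have pe : p e = x by rewrite /e permKV.
have pve : pv e = x by rewrite /pv ext_natE pe.
have pvq : pv q = p q by rewrite /pv ext_natE.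
have pvq' : pv q.+1 = p q' by rewrite /pv -qq' ext_natE.
have [lo1 lo2] : (1 <= p q /\ p q <= L)%N by move: lo; rewrite inE; lia.
have [hi1 hi2] : (k.-1 - L <= p q' /\ p q' < k.-1)%N by move: hi; rewrite inE; lia.
have ne (i : 'I_k) : p i != x -> e != i by apply: contraNneq => <-; rewrite pe.
have eq : e != q by apply: ne; rewrite -val_eqE /=; lia.
have eq' : e != q' by apply: ne; rewrite -val_eqE /=; lia.
rewrite -!val_eqE /= qq' in eq eq'.
have inner (u : 'I_k) : (u == e.+1 :> nat) || (e == u.+1 :> nat) -> (L < p u < k.-1 - L)%N.
  move=> ue; have adj : adjacent p x (p u) by rewrite /adjacent -/e permK.
  have xu : x != p u by rewrite -pe (inj_eq perm_inj) -val_eqE /=; lia.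
  have : ~~ outer (p u) by apply: contraL adj => /nadj/(_ xu).
  by rewrite /outer /=; lia.
have neq_u (u v : 'I_k) : p u <> p v :> nat -> u <> v :> nat.
  by move=> h /val_inj uv; apply: h; rewrite uv.
case: (ltnP e q) => [lt_eq|le_qe].
  have uk : (e.+1 < k)%N by have := ltn_ord q; lia.
  have := inner (Ordinal uk); rewrite eqxx => /(_ isT) /= hu.
  have uq : (e.+1 <> q) by apply: (neq_u (Ordinal uk) q); lia.
  have pvu : pv e.+1 = p (Ordinal uk) by rewrite /pv ext_natP.
  exists e; rewrite /anchored lt_eq pvq pvq' pve pvu eqxx.
  by move: hu; lia.
have e0 : (0 < e)%N by lia.
have uk : (e.-1 < k)%N by have := ltn_ord e; lia.
have := inner (Ordinal uk); rewrite /= prednK // eqxx orbT => /(_ isT) /= hu.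
have uq : (e.-1 <> q') by apply: (neq_u (Ordinal uk) q'); lia.
exists e.-1; rewrite /anchored.
have -> : (e.-1 < q)%N = false by lia.
have pvu : pv e.-1 = p (Ordinal uk) by rewrite /pv ext_natP.
rewrite prednK // pvq pvq' pve pvu eqxx.
by move: hu (ltn_ord e); lia.
Qed.

Lemma good_pattern_exists (p : 'S_k) : ~~ outer_nbr p -> ~~ no_jump p ->
  exists w b0 b1, good_pattern k (ext_nat (fun i : 'I_k => p i : nat)) w b0 b1.
Proof.
move=> nout; rewrite /no_jump -lt0n => /card_gt0P[q]; rewrite inE.
case/existsP=> q' /andP[/andP[/eqP qq' lo] hi].
have k0 : (0 < k)%N by lia.
have kl : (k.-1 < k)%N by lia.
have nadj (x : 'I_k) : (x == 0 :> nat) || (x == k.-1 :> nat) ->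
    forall z, outer z -> x != z -> ~~ adjacent p x z.
  move=> xE z oz xz; apply: contra nout => adj; apply/existsP; exists (x, z) => /=.
  by rewrite xE oz xz adj.
have [b0 an0] := @anchor_exists p q q' (Ordinal k0) qq' lo hi isT (nadj (Ordinal k0) isT).
have xE1 : (Ordinal kl == 0 :> nat) || (Ordinal kl == k.-1 :> nat) by rewrite eqxx orbT.
have [b1 an1] := @anchor_exists p q q' (Ordinal kl) qq' lo hi xE1 (nadj _ xE1).
exists q, b0, b1; split=> //.
- by move=> a ak; rewrite (ext_natP _ ak).
- move=> a b ak bk; rewrite (ext_natP _ ak) (ext_natP _ bk) => /val_inj/perm_inj.
  by move/(congr1 val).
- by rewrite -qq'.
Qed.

End RandomPattern.

(** * Most patterns are good *)

Lemma uniform_perm_prob_ge (R : realType) (k M : nat) (E : 'S_k -> Prop) :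
  (4 <= M)%N -> (32 * (M * M) * M <= k)%N ->
  (forall p : 'S_k, (exists w b0 b1,
     good_pattern k (ext_nat (fun i : 'I_k => p i : nat)) w b0 b1) -> E p) ->
  1 - 33 / M%:R <= uniform_perm_prob R E.
Proof.
move=> M4 kM goodE; set F := #|{: 'S_k}|.
(* With this [L], an outer neighbour has probability at most [32/M], and the absence of a jump at
   most [1/M] because [L >= 32 * M^2]. *)
pose L := (k %/ M)%N.
have LM : (L * M <= k)%N by exact: leq_divM.
have LM1 : (k < L.+1 * M)%N by rewrite ltn_ceil //; lia.
have L32 : (32 * (M * M) <= L)%N by rewrite /L leq_divRL //; lia.
have Lk : (L.*2 + 2 < k)%N by nia.
have F0 : (0 < F)%N by apply/card_gt0P; exists 1%g.
have bad1 : (M * #|[pred p : 'S_k | outer_nbr L p]| <= 32 * F)%N.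
  have h := card_outer_nbr Lk.
  have : (k.-1 * (M * #|[pred p : 'S_k | outer_nbr L p]|) <= k.-1 * (32 * F))%N.
    rewrite [leqLHS]mulnCA; apply: (@leq_trans (M * (8 * L.+1 * F))%N).
      by rewrite leq_mul2l h orbT.
    by rewrite !mulnA leq_mul2r; apply/orP; right; nia.
  by rewrite leq_mul2l; lia.
have bad2 : (M * #|[pred p : 'S_k | no_jump L p]| <= F)%N.
  have h := card_no_jump Lk.
  have : (L.-1 * L * (M * #|[pred p : 'S_k | no_jump L p]|) <= L.-1 * L * F)%N.
    rewrite [leqLHS]mulnCA [leqLHS]mulnC [X in (X * _ <= _)%N]mulnC.
    apply: (@leq_trans (F * (4 * k) * M)%N); first by rewrite leq_mul2r h orbT.
    rewrite -mulnA mulnC leq_mul2r; apply/orP; right.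
    have h1 : (4 * k * M <= 4 * (L.+1 * M) * M)%N by nia.
    apply: (leq_trans h1).
    have -> : (4 * (L.+1 * M) * M = L.+1 * (4 * (M * M)))%N by lia.
    have h2 : (L.+1 <= 2 * L)%N by nia.
    have h3 : (2 * (4 * (M * M)) <= L.-1)%N by nia.
    by nia.
  by rewrite leq_mul2l; nia.
have union : (F <= #|[pred p | `[< E p >]]| +
    (#|[pred p : 'S_k | outer_nbr L p]| + #|[pred p : 'S_k | no_jump L p]|))%N.
  rewrite /F; apply: (leq_trans (n := #|[pred p : 'S_k | `[< E p >] ||
      (outer_nbr L p || no_jump L p)]|)).
    apply/subset_leq_card/fintype.subsetP => p _; rewrite inE.
    case: (boolP (outer_nbr L p)) => h1; first by rewrite orbT.
    case: (boolP (no_jump L p)) => h2; first by rewrite !orbT.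
    by rewrite !orbF; apply/asboolP/goodE; exact: good_pattern_exists Lk _ h1 h2.
  by apply: (leq_trans (card_orb_le _ _)); rewrite leq_add2l; exact: card_orb_le.
rewrite /uniform_perm_prob -/F; set gd := #|_| in union *.
have M0 : 0 < M%:R :> R by rewrite ltr0n; lia.
have F0' : 0 < F%:R :> R by rewrite ltr0n.
rewrite ler_pdivlMr // -(ler_pM2r M0).
have -> : (1 - 33 / M%:R) * F%:R * M%:R = F%:R * M%:R - 33%:R * F%:R :> R.
  by field; rewrite gt_eqF.
rewrite lerBlDr -!natrM -natrD ler_nat.
set x := #|_| in bad1 union; set y := #|_| in bad2 union; nia.
Qed.

Theorem theorem3p3 (R : realType) :
  (fun k : nat =>
     uniform_perm_prob R (fun p : 'S_k =>
       nonadaptive_one_sided_Omega p (fun (eps : R) (n : nat) =>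
         eps `^ (- (1 / (k%:R - 3))) * n%:R `^ (1 - 1 / (k%:R - 3)))))
  @ \oo --> (1 : R).
Proof.
apply/cvgrPdist_le => e e0.
(* Adding 4 ensures both [33 / M <= e] and [4 <= M]. *)
pose M := (Num.truncn (33 / e)).+4.
have eM : 33 / M%:R <= e.
  rewrite ler_pdivrMr ?ltr0n // mulrC -ler_pdivrMr // ltW //.
  apply: (lt_trans (truncnS_gt _)); rewrite ltr_nat /M; move: (Num.truncn _) => x; lia.
near=> k.
have kM : (32 * (M * M) * M <= k)%N by near: k; exact: nbhs_infty_ge.
set pr := uniform_perm_prob _ _.
have pr_ge : 1 - 33 / M%:R <= pr.
  apply: uniform_perm_prob_ge => // p [w [b0 [b1 G]]]; exact: good_pattern_Omega G.
have pr_le1 : pr <= 1.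
  rewrite ler_pdivrMr ?mul1r ?ler_nat ?max_card // ltr0n.
  by apply/card_gt0P; exists 1%g.
by rewrite ger0_norm ?subr_ge0 // lerBlDr -lerBlDl (le_trans _ pr_ge) // lerD2l lerN2.
Unshelve. all: by end_near. Qed.
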